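(* Let $(W,S)$ be a Coxeter system and let $S=I\cup J$, where no element of $I$ is conjugate in $W$ to an element of $J$. Let $W_I$ be the subgroup of $W$ generated by $I$, let $\widetilde J=\{wsw^{-1} : w\in W_I,\ s\in J\}$, and let $\widetilde W$ be the subgroup of $W$ generated by $\widetilde J$. Then: (a) $\widetilde J=\chi(\widetilde W)$, i.e. $\widetilde J$ is the set of canonical Coxeter generators of the reflection subgroup $\widetilde W$ of $W$. (b) Each element $w$ of $W_I$ is the unique element of minimal length (with respect to the length function of $(W,S)$) in its coset $\widetilde W w=w\widetilde W$.
   Context: Let $T=\bigcup_{w\in W}wSw^{-1}$ be the set of reflections of $(W,S)$ and let $\ell$ be the length function of $(W,S)$. For $w\in W$ put $N(w)=\{t\in T : \ell(wt)<\ell(w)\}$. For a subgroup $W'$ of $W$ generated by reflections (elements of $T$), put $\chi(W')=\{t\in T : N(t)\cap W'=\{t\}\}$. It is known (Dyer) that $(W',\chi(W'))$ is a Coxeter system; $\chi(W')$ is called the set of canonical Coxeter generators of $W'$. *)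

(* Defs.v *)
From mathcomp Require Import all_boot all_classical.

Set Implicit Arguments.
Unset Strict Implicit.
Unset Printing Implicit Defensive.

Local Open Scope classical_set_scope.
Local Open Scope group_scope.

Section Coxeter.
Variable W : groupType.
Implicit Types (S X A H : set W) (x w t : W).

Definition has_order x (m : nat) : Prop :=
  [/\ (0 < m)%N, x ^+ m = 1
    & forall k : nat, (0 < k)%N -> x ^+ k = 1 -> (m <= k)%N].

Definition subgroup_gen X : set W :=
  smallest (fun H => group_closed (mem H)) X.

(* Bourbaki, Lie IV.1.3: S consists of elements of order 2, generates W, and
   the relations (s s')^{m(s,s')} = 1, for s, s' in S with s s' of finite order
   m(s,s'), present W; the last point is the universal property of the
   presentation.  S may be infinite.  The values of f outside S are
   irrelevant. *)
Definition coxeter_system S : Prop :=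
  [/\ forall s, S s -> has_order s 2,
      subgroup_gen S = setT
    & forall (G : groupType) (f : W -> G),
        (forall (s s' : W) (m : nat), S s -> S s' -> has_order (s * s') m ->
           (f s * f s') ^+ m = 1) ->
        exists g : {multiplicative W -> G}, forall s, S s -> g s = f s].

Definition product_of S w (n : nat) : Prop :=
  exists r : seq W,
    [/\ size r = n, forall x, x \in r -> S x & w = \prod_(x <- r) x].

(* The default value 0 is only used when w is not a product of elements of S.
   No inverses are needed, the elements of S being involutions. *)
Definition cox_length S w : nat :=
  xget 0%N [set n | product_of S w n /\
                    forall m : nat, product_of S w m -> (n <= m)%N].

Definition reflections S : set W :=
  [set t | exists w s : W, S s /\ t = w * s * w^-1].

Definition inversions S w : set W :=
  [set t | reflections S t /\ (cox_length S (w * t) < cox_length S w)%N].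

Definition reflection_subgroup S H : Prop :=
  exists2 X : set W, X `<=` reflections S & H = subgroup_gen X.

Definition canonical_generators S H : set W :=
  [set t | reflections S t /\ inversions S t `&` H = [set t]].

Definition conjugates_by H X : set W :=
  [set t | exists w s : W, [/\ H w, X s & t = w * s * w^-1]].

Definition is_conjugate x y : Prop := exists w : W, y = w * x * w^-1.

Definition right_coset H w : set W := [set h * w | h in H].
Definition left_coset w H : set W := [set w * h | h in H].

Definition minimal_length S A : set W :=
  [set x | A x /\ forall y, A y -> (cox_length S x <= cox_length S y)%N].

End Coxeter.

(* Main.v *)
Require Import Defs.
From HB Require Import structures.
From mathcomp Require Import all_boot all_classical.

Set Implicit Arguments.
Unset Strict Implicit.
Unset Printing Implicit Defensive.

Local Open Scope classical_set_scope.
Local Open Scope group_scope.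

(** Two homomorphisms given by the universal property of a Coxeter presentation
carry the proof.

The first is a retraction [p] of [W] onto [W_I] that is the identity on [I] and
sends [J] to [1] ([parabolic_retraction]).  It respects the relations because
[s s'] never has odd order for [s] in [I] and [s'] in [J]: an odd order would
make [s] and [s'] conjugate.  It is trivial on the subgroup [Wt] generated by
the [W_I]-conjugates [Jt] of [J], so [Wt] meets [W_I] trivially and contains no
conjugate of an element of [I].

Deleting from a reduced word of [x] its last letter in [J] multiplies [x] on the
right by an element of [Jt] and makes it shorter; this is possible unless [x]
lies in [W_I] ([parabolic_or_descent]).  Hence an element of minimal length in a
coset [Wt w] lies in [W_I], and [w] is the only element of that coset in [W_I]
when [w] is; this is (b).  Applied to a canonical generator [t] of [Wt], the
same descent gives an element of [Jt] in [N(t)] and in [Wt], which must be [t];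
thus [chi(Wt)] is contained in [Jt].

For the reverse inclusion one needs the substance of the strong exchange
condition: a reflection [t'] that shortens [t = w s w^-1] occurs among the
reflections attached to a word of [t], where the reflection attached to a letter
[a] of a word [u a v] is [v^-1 a v].  This comes from the second homomorphism,
from [W] to the semidirect product of [W] with the group of its subsets under
symmetric difference, sending [s] to [(s, {s})].  Its second component is the
reflection cocycle [eta], and [eta w t] holds whenever [t] is an inversion of
[w] ([inversion_cocycle]).  For [w] in [W_I] the reflections counted by [eta w]
are conjugate to elements of [I] ([cocycle_support]), hence none of them is in
[Wt].  So in the expansion of [eta (w s w^-1) t'] with [t'] in [Wt] only the
middle letter contributes, and [t' = w s w^-1]. *)

(** * Generated subgroups and words *)

Section Generation.
Variables (W : groupType) (X : set W).

Lemma subgroup_gen_closed : group_closed (mem (subgroup_gen X)).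
Proof.
split; first by rewrite inE => H [[]]; rewrite inE.
move=> u v /set_mem uX /set_mem vX; rewrite inE => H HX.
have [[_ Hdiv] _] := HX.
by apply/set_mem/(Hdiv u v); apply/mem_set; [exact: uX | exact: vX].
Qed.

Lemma subgroup_gen1 : subgroup_gen X 1.
Proof. by have [/set_mem] := subgroup_gen_closed. Qed.

Lemma subgroup_genM u v :
  subgroup_gen X u -> subgroup_gen X v -> subgroup_gen X (u * v).
Proof.
move=> uX vX; apply/set_mem.
by apply: (group_closedM subgroup_gen_closed); apply/mem_set.
Qed.

Lemma subgroup_genV u : subgroup_gen X u -> subgroup_gen X u^-1.
Proof.
move=> uX; apply/set_mem.
by apply: (group_closedV subgroup_gen_closed); apply/mem_set.
Qed.

Lemma sub_subgroup_gen x : X x -> subgroup_gen X x.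
Proof. exact: sub_gen_smallest. Qed.

Lemma subgroup_gen_ind (P : W -> Prop) :
    P 1 -> (forall x, X x -> P x) ->
    (forall u v, P u -> P v -> P (u * v)) -> (forall u, P u -> P u^-1) ->
  forall w, subgroup_gen X w -> P w.
Proof.
move=> P1 PX PM PV; apply: smallest_sub => //.
split; first by rewrite inE.
by move=> u v /set_mem Pu /set_mem Pv; rewrite inE; apply: PM => //; apply: PV.
Qed.

End Generation.

Lemma subgroup_gen_conj (W : groupType) (X : set W) u v :
  (forall x, X x -> subgroup_gen X (u * x * u^-1)) ->
  subgroup_gen X v -> subgroup_gen X (u * v * u^-1).
Proof.
move=> uX; elim/subgroup_gen_ind => [|//|x y uxX uyX|x uxX].
- by rewrite !gnorm; exact: subgroup_gen1.
- by have := subgroup_genM uxX uyX; rewrite !gnorm.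
- by have := subgroup_genV uxX; rewrite !gnorm.
Qed.

Section Morphisms.
Variables (G H : groupType) (f : {multiplicative G -> H}).

Lemma mult1 : f 1 = 1.
Proof. by apply: (mulgI (f 1)); rewrite -gmulfM !mulg1. Qed.

Lemma multV x : f x^-1 = (f x)^-1.
Proof. by apply: (mulgI (f x)); rewrite -gmulfM !mulgV mult1. Qed.

End Morphisms.

Section Words.
Variables (W : groupType) (S : set W).
Hypothesis invS : forall s, S s -> s * s = 1.

Lemma involV s : S s -> s^-1 = s.
Proof. by move=> /invS /mulg1_eq. Qed.

Lemma product_of_ind (P : W -> nat -> Prop) :
    P 1 0%N ->
    (forall s w n, S s -> product_of S w n -> P w n -> P (s * w) n.+1) ->
  forall w n, product_of S w n -> P w n.
Proof.
move=> P1 Pcons w n [r [<- rS ->]]; elim: r rS => [_|s r IHr rS].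
  by rewrite big_nil.
have r'S x : x \in r -> S x by move=> xr; apply/rS; rewrite inE xr orbT.
rewrite big_cons; apply: Pcons; [exact/rS/mem_head | by exists r | exact: IHr].
Qed.

Lemma product_of_one : product_of S 1 0.
Proof. by exists [::]; split => //; rewrite big_nil. Qed.

Lemma product_of_cons s w n :
  S s -> product_of S w n -> product_of S (s * w) n.+1.
Proof.
move=> Ss [r [<- rS ->]]; exists (s :: r); split=> //; last by rewrite big_cons.
by move=> x; rewrite inE => /predU1P[->|/rS].
Qed.

Hypothesis genS : subgroup_gen S = setT.

Lemma product_of_exists w : exists n, product_of S w n.
Proof.
(* Words are extended on the left by [u] and by [u^-1] simultaneously, since
   induction on generation does not reduce one case to the other. *)
suff gen_word u : subgroup_gen S u ->
    (forall v n, product_of S v n -> exists m, product_of S (u * v) m) /\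
    (forall v n, product_of S v n -> exists m, product_of S (u^-1 * v) m).
  have [] := gen_word w; first by rewrite genS.
  by move=> /(_ 1 0%N product_of_one); rewrite mulg1.
elim/subgroup_gen_ind => {u}.
- by rewrite invg1; split=> v n; rewrite mul1g; exists n.
- by move=> s Ss; rewrite involV //; split=> v n vn;
    exists n.+1; apply: product_of_cons.
- move=> x y [xl xVl] [yl yVl]; rewrite invgM; split=> v n; rewrite -!mulgA.
    by case/yl => ? /xl.
  by case/xVl => ? /yVl.
- by move=> x [xl xVl]; rewrite invgK.
Qed.

Lemma cox_length_spec w :
  product_of S w (cox_length S w) /\
  forall m, product_of S w m -> (cox_length S w <= m)%N.
Proof.
have [n wn] := product_of_exists w.
have ex_word : exists n, `[< product_of S w n >] by exists n; apply/asboolP.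
rewrite /cox_length; set P := [set n | _].
apply: (@xgetPex _ 0%N P); exists (ex_minn ex_word).
by case: ex_minnP => k /asboolP wk kmin; split=> // m /asboolP /kmin.
Qed.

Lemma cox_length_word w : product_of S w (cox_length S w).
Proof. by have [] := cox_length_spec w. Qed.

Lemma cox_length_le w m : product_of S w m -> (cox_length S w <= m)%N.
Proof. by have [_] := cox_length_spec w; apply. Qed.

End Words.

(** * The reflection cocycle *)

Section SemidirectProduct.
Variable W : groupType.

(** A subset of [W] is a function [W -> bool] and [(+)] is symmetric difference;
[W] acts on subsets by conjugation.  Subsets of the whole group are used, rather
than sets of reflections, so that the action needs no stability proof. *)
Definition subset_extension : Type := (W * (W -> bool))%type.

HB.instance Definition _ := Choice.copy subset_extension (W * (W -> bool))%type.

Implicit Types x y z : subset_extension.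

Definition ext_mul x y : subset_extension :=
  (x.1 * y.1, fun t => x.2 (t ^ y.1^-1) (+) y.2 t).
Definition ext_one : subset_extension := (1, fun=> false).
Definition ext_inv x : subset_extension := (x.1^-1, fun t => x.2 (t ^ x.1)).

Lemma ext_mulA : associative ext_mul.
Proof.
move=> x y z; rewrite /ext_mul /= mulgA; congr pair; apply/funext => t.
by rewrite invgM conjgM addbA.
Qed.

Lemma ext_mul1 : left_id ext_one ext_mul.
Proof. by case=> w f; rewrite /ext_mul /= mul1g. Qed.

Lemma ext_mulr1 : right_id ext_one ext_mul.
Proof.
case=> w f; rewrite /ext_mul /= mulg1; congr pair; apply/funext => t.
by rewrite invg1 conjg1 addbF.
Qed.

Lemma ext_mulV : left_inverse ext_one ext_inv ext_mul.
Proof.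
case=> w f; rewrite /ext_mul /= mulVg; congr pair; apply/funext => t.
by rewrite conjgKV addbb.
Qed.

Lemma ext_mulrV : right_inverse ext_one ext_inv ext_mul.
Proof.
case=> w f; rewrite /ext_mul /= mulgV; congr pair; apply/funext => t.
by rewrite invgK addbb.
Qed.

HB.instance Definition _ := isGroup.Build subset_extension
  ext_mulA ext_mul1 ext_mulr1 ext_mulV ext_mulrV.

Definition marked s : subset_extension := (s, fun t => t == s).

(** The subset counts, modulo 2, the reflections attached to the alternating
word [s s' ... s s'] of length [2n]; read from the right end they are
[s'], [s' s s'], ..., that is [(s' s)^k s'] for [k < 2n]. *)
Lemma marked_expg s s' n : s * s = 1 -> s' * s' = 1 ->
  (marked s * marked s') ^+ n =
  ((s * s') ^+ n,
   fun t => \big[addb/false]_(0 <= k < n.*2) (t == (s' * s) ^+ k * s')).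
Proof.
move=> ss s's'; have [sV s'V] := (mulg1_eq ss, mulg1_eq s's').
elim: n => [|n IHn].
  by rewrite !expg0; congr pair; apply/funext => t; rewrite big_nil.
rewrite expgSr IHn; congr pair; first by rewrite expgSr.
apply/funext => t /=.
rewrite doubleS !big_nat_recl // addbC -addbA addbCA.
congr (_ (+) (_ (+) _)).
- by rewrite expg0 mul1g.
- by rewrite expg1 -(inj_eq (@conjg_inj _ s')) conjgKV conjgE s'V mulgA.
apply: eq_bigr => k _.
rewrite -(inj_eq (@conjg_inj _ (s * s'))) conjgKV conjgE invgM sV s'V.
by rewrite expgS expgSr !mulgA.
Qed.

(** When [(s s')^m = 1] the sequence [(s' s)^k s'] is periodic of period [m], so
each reflection of the relator is counted an even number of times. *)
Lemma marked_relation s s' m : s * s = 1 -> s' * s' = 1 ->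
  (s * s') ^+ m = 1 -> (marked s * marked s') ^+ m = 1.
Proof.
move=> ss s's' relm; rewrite marked_expg // relm; congr pair.
have relm' : (s' * s) ^+ m = 1.
  have [sV s'V] := (mulg1_eq ss, mulg1_eq s's').
  by rewrite -sV -s'V -invgM expVgn relm invg1.
apply/funext => t.
rewrite -addnn big_mkord big_split_ord /=.
under [X in _ (+) X]eq_bigr do rewrite expgnDr relm' mul1g.
exact: addbb.
Qed.

End SemidirectProduct.

Section ReflectionCocycle.
Variables (W : groupType) (S : set W).
Hypothesis coxS : coxeter_system S.

Lemma cox_invol s : S s -> s * s = 1.
Proof. by have [ordS _ _] := coxS; move=> /ordS[_]; rewrite expg2. Qed.

Lemma cox_neq1 s : S s -> s <> 1.
Proof.
have [ordS _ _] := coxS.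
by move=> /ordS[_ _ /(_ 1%N isT)] + s1; rewrite s1 => /(_ erefl).
Qed.

Lemma reflection_neq1 t : reflections S t -> t <> 1.
Proof.
case=> w [s [Ss ->]] /(congr1 (conjg^~ w)).
by rewrite conj1g conjgE !gnorm; exact: cox_neq1.
Qed.

Lemma cox_gen : subgroup_gen S = setT.
Proof. by have [] := coxS. Qed.

(** [eta w t] is the parity of the number of occurrences of [t] among the
reflections attached to any word of [w]; on reflections it is the indicator of
[N(w)], and the first equation is [N(v w) = w^-1 N(v) w + N(w)]. *)
Definition reflection_cocycle (eta : W -> W -> bool) : Prop :=
  (forall v w t, eta (v * w) t = eta v (t ^ w^-1) (+) eta w t) /\
  (forall s, S s -> forall t, eta s t = (t == s)).

Lemma reflection_cocycle_exists : exists eta, reflection_cocycle eta.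
Proof.
have [_ _ univ] := coxS.
have [s s' m Ss Ss' [_ relm _]|g gS] := univ _ (@marked W).
  exact: marked_relation (cox_invol Ss) (cox_invol Ss') relm.
have g1 w : (g w).1 = w.
  have: subgroup_gen S w by rewrite cox_gen.
  elim/subgroup_gen_ind => [|s Ss|u v u1 v1|u u1].
  - by rewrite mult1.
  - by rewrite gS.
  - by rewrite gmulfM /= u1 v1.
  - by rewrite multV /= u1.
exists (fun w => (g w).2); split=> [v w t|s Ss t]; last by rewrite gS.
by rewrite gmulfM /= g1.
Qed.

Variable eta : W -> W -> bool.
Hypothesis etaC : reflection_cocycle eta.

Let etaM v w t : eta (v * w) t = eta v (t ^ w^-1) (+) eta w t.
Proof. by case: etaC. Qed.

Let etaS s t : S s -> eta s t = (t == s).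
Proof. by move=> Ss; rewrite (proj2 etaC). Qed.

Lemma cocycle1 t : eta 1 t = false.
Proof.
by have := etaM 1 1 t; rewrite mulg1 invg1 conjg1 addbb.
Qed.

Lemma cocycleV w t : eta w^-1 t = eta w (t ^ w).
Proof.
have := cocycle1 t; rewrite -(mulgV w) etaM invgK.
by case: (eta w _); case: (eta _ _).
Qed.

Lemma cocycle_reflection w s t : S s ->
  eta (w * s * w^-1) t =
    eta w ((t ^ w) ^ s) (+) (t ^ w == s) (+) eta w (t ^ w).
Proof.
move=> Ss; rewrite !etaM invgK cocycleV (etaS (t ^ w) Ss).
by rewrite (involV cox_invol Ss).
Qed.

(** If [t] is counted by the cocycle then it is attached to some letter of the
word, and multiplying by [t] deletes that letter. *)
Lemma cocycle_descent w n t : product_of S w n -> eta w t ->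
  exists2 m, (m < n)%N & product_of S (w * t) m.
Proof.
elim/product_of_ind => {w n} [|s w n Ss wn IHw]; first by rewrite cocycle1.
case: (boolP (eta w t)) => [/IHw[m ltmn wtm] _|].
  by exists m.+1 => //; rewrite -mulgA; apply: product_of_cons.
rewrite etaM => /negbTE ->; rewrite addbF etaS // => /eqP ts.
exists n => //; suff -> : s * w * t = w by [].
have -> : t = s ^ w by rewrite -ts conjgKV.
by rewrite -mulgA -conjgC mulgA cox_invol // mul1g.
Qed.

(** The step behind the strong exchange condition.  A reflection satisfies [eta t t], so
[eta (w t) t] is the negation of [eta w t]; if the latter failed,
[cocycle_descent] for [w t] would make [w = w t t] shorter than [w t]. *)
Lemma inversion_cocycle w t : inversions S w t -> eta w t.
Proof.
case=> -[v [s [Ss tE]]] ltwt.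
have tv : t ^ v = s by rewrite tE conjgE !gnorm.
have etatt : eta t t.
  rewrite {1}tE cocycle_reflection // tv eqxx.
  have -> : s ^ s = s by rewrite conjgE mulKg.
  by case: (eta _ _).
have tt : t * t = 1.
  by rewrite tE !gnorm -(mulgA v) cox_invol // mulg1 mulgV.
case: (boolP (eta w t)) => // nwt.
have etawt : eta (w * t) t.
  by rewrite etaM etatt conjgE mulgV mulg1 invgK (negbTE nwt).
have [m ltm] := cocycle_descent (cox_length_word cox_invol cox_gen (w * t)) etawt.
rewrite -mulgA tt mulg1 => /(cox_length_le cox_invol cox_gen) lew.
by have := leq_ltn_trans lew (ltn_trans ltm ltwt); rewrite ltnn.
Qed.

(** The reflections attached to a word are conjugates of its letters. *)
Lemma cocycle_support X w t : X `<=` S -> subgroup_gen X w -> eta w t ->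
  exists2 s, X s & is_conjugate s t.
Proof.
move=> XS wX; elim/subgroup_gen_ind: w / wX t => [t|s Xs t|u v IHu IHv t|u IHu t].
- by rewrite cocycle1.
- rewrite etaS; last exact: XS.
  by move=> /eqP ->; exists s => //; exists 1; rewrite !gnorm.
- rewrite etaM; case: (boolP (eta v t)) => [/IHv //|_]; rewrite addbF.
  move=> /IHu[s Xs [x tx]]; exists s => //; exists (v^-1 * x).
  by rewrite -[t](conjgKV v) tx conjgE !gnorm.
- rewrite cocycleV => /IHu[s Xs [x tx]]; exists s => //; exists (u * x).
  by rewrite -[t](conjgK u) tx conjgE !gnorm.
Qed.

End ReflectionCocycle.

Lemma is_conjugate_sym (W : groupType) (x y : W) :
  is_conjugate x y -> is_conjugate y x.
Proof. by case=> w ->; exists w^-1; rewrite !gnorm. Qed.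

(** For [m = 2k + 1] the conjugating element is [(s s')^k]. *)
Lemma dihedral_odd_conjugate (W : groupType) (s s' : W) m :
  s * s = 1 -> s' * s' = 1 -> (s * s') ^+ m = 1 -> odd m -> is_conjugate s s'.
Proof.
move=> ss s's' relm oddm.
have [sV s'V] := (mulg1_eq ss, mulg1_eq s's').
set c := (s * s') ^+ m./2.
have sc : s * c^-1 = c * s.
  have : (s * s') ^ s = (s * s')^-1.
    by rewrite conjgE invgM sV s'V !mulgA ss mul1g.
  move=> /(congr1 (fun x => x ^+ m./2)); rewrite -conjXg expVgn => h.
  by rewrite -h conjgE sV !mulgA ss mul1g.
exists c; rewrite -sc -mulgA -invgM -[LHS](mulKg s) sV; congr (s * _).
apply: (mulgI c); rewrite invgM mulVKg -[LHS](mulgK c) -[RHS]mul1g; congr (_ * _).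
move: relm; rewrite -(odd_double_half m) oddm add1n -addnn -addnS expgnDr => <-.
by rewrite expgS !mulgA.
Qed.

(** * The retraction onto the parabolic subgroup and the descent *)

Section Decomposition.
Variables (W : groupType) (S I J : set W).
Hypotheses (coxS : coxeter_system S) (S_IJ : S = I `|` J).
Hypothesis nconjIJ : forall s t : W, I s -> J t -> ~ is_conjugate s t.

Let W_I := subgroup_gen I.
Let Jt := conjugates_by W_I J.
Let Wt := subgroup_gen Jt.

Let subIS : I `<=` S. Proof. by rewrite S_IJ; left. Qed.
Let subJS : J `<=` S. Proof. by rewrite S_IJ; right. Qed.

Let invS := cox_invol coxS.
Let lenS := cox_length_word invS (cox_gen coxS).
Let leS := cox_length_le invS (cox_gen coxS).

Lemma parabolic_retraction : exists p : {multiplicative W -> W},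
  (forall s, I s -> p s = s) /\ (forall s, J s -> p s = 1).
Proof.
have [_ _ univ] := coxS.
pose f s := if s \in I then s else 1.
have fI s : I s -> f s = s by rewrite /f => /mem_set ->.
have fJ s : J s -> f s = 1.
  move=> Js; rewrite /f; case: ifPn => // /set_mem Is.
  by case: (nconjIJ Is Js); exists 1; rewrite !gnorm.
have even_pow s m : S s -> ~~ odd m -> s ^+ m = 1.
  move=> Ss evenm; rewrite -(odd_double_half m) (negbTE evenm) add0n -mul2n.
  by rewrite expgnA expg2 invS // expg1n.
have [s s' m Ss Ss' [_ relm _]|p pS] := univ W f; last first.
  exists p; split=> s Xs; first by rewrite (pS _ (subIS Xs)) fI.
  by rewrite (pS _ (subJS Xs)) fJ.
have conj_odd : odd m -> is_conjugate s s'.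
  by apply: dihedral_odd_conjugate relm; apply: invS.
move: (Ss) (Ss'); rewrite {1 2}S_IJ => -[Xs|Xs] [Xs'|Xs'].
- by rewrite !fI.
- rewrite fI // fJ // mulg1; apply: even_pow => //; apply/negP => /conj_odd.
  exact: nconjIJ.
- rewrite fJ // fI // mul1g; apply: even_pow => //; apply/negP => /conj_odd.
  by move=> /is_conjugate_sym; apply: nconjIJ.
- by rewrite !fJ // mulg1 expg1n.
Qed.

Lemma parabolic_conj_Jt u t : W_I u -> Jt t -> Jt (u * t * u^-1).
Proof.
move=> uI [w [s [wI Js ->]]]; exists (u * w), s.
by split=> //; [exact: subgroup_genM | rewrite !gnorm].
Qed.

Lemma parabolic_normalizes u x : W_I u -> Wt x -> Wt (u * x * u^-1).
Proof.
move=> uI; apply: subgroup_gen_conj => t tJ.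
apply: sub_subgroup_gen; exact: parabolic_conj_Jt.
Qed.

Lemma retraction_parabolic (p : {multiplicative W -> W}) w :
  (forall s, I s -> p s = s) -> W_I w -> p w = w.
Proof.
move=> pI; elim/subgroup_gen_ind => [|s /pI //|u v pu pv|u pu].
- exact: mult1.
- by rewrite gmulfM pu pv.
- by rewrite multV pu.
Qed.

Lemma retraction_kernel (p : {multiplicative W -> W}) w :
  (forall s, J s -> p s = 1) -> Wt w -> p w = 1.
Proof.
move=> pJ; elim/subgroup_gen_ind => [|t [u [s [_ Js ->]]]|u v pu pv|u pu].
- exact: mult1.
- by rewrite !gmulfM (pJ _ Js) mulg1 -gmulfM mulgV mult1.
- by rewrite gmulfM pu pv mulg1.
- by rewrite multV pu invg1.
Qed.

Lemma parabolic_coset_inj h w : Wt h -> W_I w -> W_I (h * w) -> h = 1.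
Proof.
have [p [pI pJ]] := parabolic_retraction.
move=> hW wI hwI; have hI : W_I h.
  by rewrite -(mulgK w h); apply: subgroup_genM => //; apply: subgroup_genV.
by rewrite -(retraction_parabolic pI hI) retraction_kernel.
Qed.

Lemma Wt_not_conj_I s t : I s -> Wt t -> ~ is_conjugate s t.
Proof.
have [p [pI pJ]] := parabolic_retraction.
move=> Is tW [v tv]; have := retraction_kernel pJ tW.
rewrite tv !gmulfM multV (pI _ Is); apply: (reflection_neq1 coxS).
by exists (p v), s; split=> //; apply: subIS.
Qed.

(** The element [t] is read off a reduced word of [x]: it is the conjugate, by
the part of the word to the right of it, of the last letter in [J]. *)
Lemma parabolic_or_descent x : W_I x \/
  exists2 t, Jt t & (cox_length S (x * t) < cox_length S x)%N.
Proof.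
suff word_descent w n : product_of S w n ->
    W_I w \/ exists2 t, Jt t & exists2 m, (m < n)%N & product_of S (w * t) m.
  have [|[t tJ [m ltm /leS lem]]] := word_descent _ _ (lenS x); [by left | right].
  by exists t => //; apply: leq_ltn_trans ltm.
elim/product_of_ind => {w n} [|s w n Ss wn [wI|[t tJ [m ltmn wtm]]]].
- by left; exact: subgroup_gen1.
- move: (Ss); rewrite {1}S_IJ => -[Is|Js].
    by left; apply: subgroup_genM => //; apply: sub_subgroup_gen.
  right; exists (w^-1 * s * w).
    by exists w^-1, s; rewrite invgK; split=> //; apply: subgroup_genV.
  by exists n => //; rewrite !mulgA mulgK invS // mul1g.
- right; exists t => //; exists m.+1 => //.
  by rewrite -mulgA; apply: product_of_cons.
Qed.

Lemma coset_mul_Jt w x t : W_I w ->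
  right_coset Wt w x -> Jt t -> right_coset Wt w (x * t).
Proof.
move=> wI [h hW <-] tJ; exists (h * (w * t * w^-1)); last by rewrite !gnorm.
apply: subgroup_genM => //; apply: sub_subgroup_gen; exact: parabolic_conj_Jt.
Qed.

Lemma coset_parabolic w x : W_I w -> right_coset Wt w x -> W_I x -> x = w.
Proof.
by move=> wI [h hW <-] hwI; rewrite (parabolic_coset_inj hW wI hwI) mul1g.
Qed.

Lemma minimal_length_coset w : W_I w ->
  minimal_length S (right_coset Wt w) = [set w].
Proof.
move=> wI; apply/seteqP; split=> [x [xw xmin]|_ ->].
  have [|[t tJ]] := parabolic_or_descent x; first exact: coset_parabolic.
  by rewrite ltnNge xmin //; apply: coset_mul_Jt.
split; first by exists 1; [exact: subgroup_gen1 | rewrite mul1g].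
move=> y; have [n] := ubnP (cox_length S y).
elim: n y => // n IHn y; rewrite ltnS => leyn yw.
have [/(coset_parabolic wI yw) -> //|[t tJ lty]] := parabolic_or_descent y.
apply/ltnW/(leq_ltn_trans _ lty)/IHn; last exact: coset_mul_Jt.
exact: leq_trans lty leyn.
Qed.

Lemma right_left_coset w : W_I w -> right_coset Wt w = left_coset w Wt.
Proof.
move=> wI; apply/seteqP; split=> _ [h hW <-].
  exists (w^-1 * h * w^-1^-1); last by rewrite !gnorm.
  by apply: parabolic_normalizes => //; apply: subgroup_genV.
by exists (w * h * w^-1); [exact: parabolic_normalizes | rewrite !gnorm].
Qed.

Lemma Jt_reflections : Jt `<=` reflections S.
Proof. by move=> _ [w [s [_ Js ->]]]; exists w, s; split=> //; apply: subJS. Qed.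

Lemma canonical_generators_sub_Jt : canonical_generators S Wt `<=` Jt.
Proof.
move=> t [tR /seteqP[sub_t t_in]].
have [_ tW] := t_in t erefl.
have [tI|[u uJ ltu]] := parabolic_or_descent t; last first.
  suff <- : u = t by [].
  by apply: sub_t; split; [split=> //; apply: Jt_reflections
                          | apply: sub_subgroup_gen].
case: (reflection_neq1 coxS tR).
by apply: (@parabolic_coset_inj t 1) => //; [exact: subgroup_gen1|rewrite mulg1].
Qed.

Lemma Jt_sub_canonical_generators : Jt `<=` canonical_generators S Wt.
Proof.
move=> t tJ; have [w [s [wI Js tw]]] := tJ; have Ss := subJS Js.
have tR := Jt_reflections tJ.
split=> //; apply/seteqP; split=> [t' [t'inv t'W]|_ ->].
  have [eta etaC] := reflection_cocycle_exists coxS.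
  (* In the expansion of [eta t t'] the letters of [w] and [w^-1] contribute
     nothing, since they are in [I] and [t'] is in [Wt]. *)
  have eta0 v : is_conjugate v t' -> eta w v = false.
    move=> vt'; apply/negP => /(cocycle_support etaC subIS wI)[i Ii iv].
    apply: (Wt_not_conj_I Ii t'W); case: iv vt' => a -> [b ->].
    by exists (b * a); rewrite !gnorm.
  have := inversion_cocycle coxS etaC t'inv.
  rewrite tw (cocycle_reflection coxS etaC) // !eta0; first 1 last.
  - by exists w; rewrite conjgE !gnorm.
  - by exists (w * s); rewrite -conjgM conjgE !gnorm.
  by rewrite addbF => /eqP <-; rewrite conjgE !gnorm.
split; last exact: sub_subgroup_gen.
split=> //; have tt : t * t = 1.
  by rewrite tw !gnorm -(mulgA w) invS // mulg1 mulgV.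
have len1 : cox_length S 1 = 0%N.
  by apply/eqP; rewrite -leqn0; apply: leS; exact: product_of_one.
rewrite tt len1 lt0n; apply/eqP => len0.
have := lenS t; rewrite len0 => -[r [/size0nil -> _]]; rewrite big_nil => t1.
exact: (reflection_neq1 coxS tR).
Qed.

End Decomposition.

Theorem mainTheorem1 (W : groupType) (S I J : set W)
    (coxS : coxeter_system S)
    (S_IJ : S = I `|` J)
    (nconjIJ : forall s t : W, I s -> J t -> ~ is_conjugate s t) :
  let W_I := subgroup_gen I in
  let Jt := conjugates_by W_I J in
  let Wt := subgroup_gen Jt in
  (reflection_subgroup S Wt /\ Jt = canonical_generators S Wt) /\
  (forall w : W, W_I w ->
     right_coset Wt w = left_coset w Wt /\
     minimal_length S (right_coset Wt w) = [set w]).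
Proof.
move=> W_I Jt Wt; split; first split.
- by exists Jt => //; apply: Jt_reflections.
- apply/seteqP; split.
    exact: Jt_sub_canonical_generators.
  exact: canonical_generators_sub_Jt.
- move=> w wI; split; first exact: right_left_coset.
  exact: minimal_length_coset.
Qed.
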